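(* Let $\Omega_k=B(0,k)$ for $k\in\mathbb{N}$ and $\Omega=\bigcup_{k\in\mathbb{N}}B(0,k)=\mathbb{R}^n$. Let $H(x,p)=H(p)$ for $(x,p)\in\mathbb{R}^n\times\mathbb{R}^n$, where $H$ is locally Lipschitz and coercive in $\mathbb{R}^n$ ($H(p)\to+\infty$ as $|p|\to\infty$). For $k\in\mathbb{N}$ let $u_k$ be the unique state-constraint viscosity solution of $u_k(x)+H(Du_k(x))=0$ in $B(0,k)$, and let $u$ be the unique state-constraint viscosity solution of $u(x)+H(Du(x))=0$ in $\mathbb{R}^n$. Then $u\equiv -H(0)$, and for every $x\in\overline{B(0,k)}$, $$0\le u_k(x)-u(x)\le \left(Ce^{\frac{|x|}{C}}\right)e^{-\frac{k}{C}},$$ where $C$ is a constant depending only on $H$. In particular, for any fixed $R>0$, $$0\le u_k(x)-u(x)\le \left(Ce^{\frac{R}{C}}\right)e^{-\frac{k}{C}}\qquad\text{for every }x\in\overline{B(0,R)}\text{ and }k\ge R.$$ In addition to that, this rate is optimal.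
   Context: $\mathbb{N}=\{1,2,\dots\}$; $B(0,r)$ is the open ball of radius $r$ centered at $0$ in $\mathbb{R}^n$. BUC denotes bounded uniformly continuous functions. For an open set $\Omega\subset\mathbb{R}^n$ and a continuous $H$: $v\in \mathrm{BUC}(\Omega;\mathbb{R})$ is a viscosity subsolution of $v+H(Dv)=0$ in $\Omega$ if for every $x\in\Omega$ and $\varphi\in C^1(\Omega)$ such that $v-\varphi$ has a local maximum over $\Omega$ at $x$, $v(x)+H(D\varphi(x))\le 0$. $v\in \mathrm{BUC}(\overline\Omega;\mathbb{R})$ is a viscosity supersolution on $\overline\Omega$ if for every $x\in\overline\Omega$ and $\varphi\in C^1(\overline\Omega)$ such that $v-\varphi$ has a local minimum over $\overline\Omega$ at $x$, $v(x)+H(D\varphi(x))\ge 0$. A state-constraint viscosity solution in $\Omega$ is a function that is both a viscosity subsolution in $\Omega$ and a viscosity supersolution on $\overline\Omega$. For $\Omega=\mathbb{R}^n$ this is the usual notion of viscosity solution in $\mathrm{BUC}(\mathbb{R}^n)$. Under the hypotheses of the claim, such solutions exist and are unique. *)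

(* Defs.v *)
From HB Require Import structures.
From mathcomp Require Import all_boot all_order all_algebra.
From mathcomp Require Import all_classical all_reals all_analysis.
Set Implicit Arguments.
Unset Strict Implicit.
Unset Printing Implicit Defensive.
Import Order.TTheory GRing.Theory Num.Theory.
Import numFieldNormedType.Exports.
Local Open Scope classical_set_scope.
Local Open Scope ring_scope.

Section StateConstraint.
Variables (R : realType) (n : nat).
Notation E := 'rV[R]_n.
Implicit Types (x y p : E) (v phi H : E -> R) (A Omega : set E).

(* The library norm on ['rV[R]_n] is the sup norm, hence a separate
   Euclidean norm; the two induce the same topology and uniformity. *)
Definition enorm x : R := Num.sqrt (\sum_i x ord0 i ^+ 2).

Definition eball (r : R) : set E := [set x | enorm x < r].

Definition grad phi x : E := \row_i 'D_(delta_mx ord0 i) phi x.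

(* C^1 on an open neighbourhood of [A].  For [A] open this is C^1(A); for [A]
   the closure of a domain, it gives D phi a meaning at boundary points. *)
Definition C1_on A phi : Prop :=
  exists U : set E, [/\ open U, A `<=` U,
    (forall x, U x -> differentiable phi x)
  & (forall x, U x -> {for x, continuous (grad phi)})].

Definition BUC A v : Prop :=
  [bounded v x | x in A] /\
  (forall eps : R, 0 < eps -> exists2 delta : R, 0 < delta &
     forall x y, A x -> A y -> enorm (x - y) < delta -> `|v x - v y| < eps).

Definition local_max_over A v x : Prop := \forall y \near x, A y -> v y <= v x.

Definition local_min_over A v x : Prop := \forall y \near x, A y -> v x <= v y.

(* Functions are total; their values outside [Omega] (resp. its closure) are
   irrelevant in the next three definitions. *)
Definition viscosity_subsolution H Omega v : Prop :=
  BUC Omega v /\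
  forall x phi, Omega x -> C1_on Omega phi ->
    local_max_over Omega (fun y => v y - phi y) x ->
    v x + H (grad phi x) <= 0.

Definition viscosity_supersolution H Omega v : Prop :=
  BUC (closure Omega) v /\
  forall x phi, closure Omega x -> C1_on (closure Omega) phi ->
    local_min_over (closure Omega) (fun y => v y - phi y) x ->
    0 <= v x + H (grad phi x).

Definition state_constraint_solution H Omega v : Prop :=
  viscosity_subsolution H Omega v /\ viscosity_supersolution H Omega v.

Definition locally_lipschitz H : Prop :=
  forall p, exists2 U : set E, nbhs p U & [lipschitz H q | q in U].

Definition coercive H : Prop :=
  forall M : R, exists r : R, forall p, r < enorm p -> M <= H p.

End StateConstraint.

(* Main.v *)
Require Import Defs.
From HB Require Import structures.
From mathcomp Require Import all_boot all_order all_algebra.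
From mathcomp Require Import all_classical all_reals all_analysis.
From mathcomp Require Import ring lra.
Import Order.TTheory GRing.Theory Num.Theory.
Import numFieldNormedType.Exports.
Local Open Scope classical_set_scope.
Local Open Scope ring_scope.
Set Implicit Arguments.
Unset Strict Implicit.

(** Translating by [- H 0], let [w = u_k + H 0] and [G = H - H 0].  Testing
    with [0] at a minimum point over the closed ball gives [w >= 0]; testing
    with flat paraboloids on the whole space gives [u = - H 0].  Local
    Lipschitz continuity at [0] and coercivity give [G >= - C] and
    [G p >= - C |p|], so that [w <= C] and [w <= C |Dw|]; hence [w] lies below
    [C expR ((|x| - k) / C)], which equals [C] on the boundary and solves
    [w = C |Dw|].

    This profile is itself the solution for [H p = C (||p| - 1| - 1)], which
    equals [- C |p|] where [|p| <= 1], is minimal on the unit sphere, and is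
    coercive. *)

(** * Euclidean inner product and norm *)

Definition dot {R : realType} {n : nat} (u v : 'rV[R]_n) : R :=
  \sum_i u ord0 i * v ord0 i.

Lemma dotC (R : realType) (n : nat) (u v : 'rV[R]_n) : dot u v = dot v u.
Proof. by apply: eq_bigr => i _; rewrite mulrC. Qed.

Lemma dotDl (R : realType) (n : nat) (u v w : 'rV[R]_n) :
  dot (u + v) w = dot u w + dot v w.
Proof. by rewrite -big_split; apply: eq_bigr => i _; rewrite mxE mulrDl. Qed.

Lemma dotZl (R : realType) (n : nat) (a : R) (u v : 'rV[R]_n) :
  dot (a *: u) v = a * dot u v.
Proof. by rewrite mulr_sumr; apply: eq_bigr => i _; rewrite mxE mulrA. Qed.

Lemma dotDr (R : realType) (n : nat) (u v w : 'rV[R]_n) :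
  dot u (v + w) = dot u v + dot u w.
Proof. by rewrite dotC dotDl !(dotC u). Qed.

Lemma dotZr (R : realType) (n : nat) (a : R) (u v : 'rV[R]_n) :
  dot u (a *: v) = a * dot u v.
Proof. by rewrite dotC dotZl dotC. Qed.

Lemma dotvv_ge0 (R : realType) (n : nat) (u : 'rV[R]_n) : 0 <= dot u u.
Proof. by apply: sumr_ge0 => i _; rewrite -expr2 sqr_ge0. Qed.

Lemma enormE (R : realType) (n : nat) (u : 'rV[R]_n) :
  enorm u = Num.sqrt (dot u u).
Proof. by congr Num.sqrt; apply: eq_bigr => i _; rewrite expr2. Qed.

Lemma sqr_enorm (R : realType) (n : nat) (u : 'rV[R]_n) :
  enorm u ^+ 2 = dot u u.
Proof. by rewrite enormE sqr_sqrtr// dotvv_ge0. Qed.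

Lemma enorm_ge0 (R : realType) (n : nat) (u : 'rV[R]_n) : 0 <= enorm u.
Proof. exact: sqrtr_ge0. Qed.

Lemma enormZ (R : realType) (n : nat) (a : R) (u : 'rV[R]_n) :
  enorm (a *: u) = `|a| * enorm u.
Proof.
rewrite !enormE dotZl dotZr mulrA -expr2 sqrtrM ?sqr_ge0//.
by rewrite sqrtr_sqr.
Qed.

Lemma enormN (R : realType) (n : nat) (u : 'rV[R]_n) : enorm (- u) = enorm u.
Proof. by rewrite -scaleN1r enormZ normrN1 mul1r. Qed.

Lemma enorm0 (R : realType) (n : nat) : enorm (0 : 'rV[R]_n) = 0.
Proof. by rewrite -(scale0r (0 : 'rV[R]_n)) enormZ normr0 mul0r. Qed.

Lemma enorm_eq0 (R : realType) (n : nat) (u : 'rV[R]_n) :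
  enorm u = 0 -> u = 0.
Proof.
move=> u0; have /eqP : dot u u = 0 by rewrite -sqr_enorm u0 expr0n.
rewrite psumr_eq0; last by move=> i _; rewrite -expr2 sqr_ge0.
move=> /allP u00; apply/rowP => i; rewrite mxE; apply/eqP.
by have := u00 i (mem_index_enum i); rewrite mulf_eq0 orbb.
Qed.

Lemma dot_le_enorm (R : realType) (n : nat) (u v : 'rV[R]_n) :
  dot u v <= enorm u * enorm v.
Proof.
have [/enorm_eq0 ->|u0] := eqVneq (enorm u) 0.
  by rewrite -(scale0r u) dotZl enormZ normr0 !mul0r.
have u_gt0 : 0 < enorm u by rewrite lt_def u0 enorm_ge0.
apply: le_trans (ler_norm _) _.
rewrite -(ler_pXn2r (n := 2)) ?nnegrE ?mulr_ge0 ?enorm_ge0//.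
rewrite real_normK ?num_real//.
rewrite exprMn !sqr_enorm -(ler_pM2l (exprn_gt0 2 u_gt0)) sqr_enorm -subr_ge0.
(* The square of [(u.u) v - (u.v) u] expands to [u.u] times the Cauchy-Schwarz defect; this is why
   both sides were first multiplied by [enorm u ^+ 2]. *)
have := dotvv_ge0 (dot u u *: v + (- dot u v) *: u).
rewrite !(dotDl, dotDr, dotZl, dotZr) (dotC v u).
by congr (_ <= _); ring.
Qed.

Lemma enormD (R : realType) (n : nat) (u v : 'rV[R]_n) :
  enorm (u + v) <= enorm u + enorm v.
Proof.
rewrite -(ler_pXn2r (n := 2)) ?nnegrE ?addr_ge0 ?enorm_ge0// sqrrD !sqr_enorm.
rewrite !(dotDl, dotDr) (dotC v u).
have := dot_le_enorm u v; lra.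
Qed.

Lemma enorm_sub_le (R : realType) (n : nat) (u v : 'rV[R]_n) :
  enorm u - enorm v <= enorm (u - v).
Proof. by have := enormD (u - v) v; rewrite subrK lerBlDr. Qed.

Lemma enorm_dist_le (R : realType) (n : nat) (u v : 'rV[R]_n) :
  `|enorm u - enorm v| <= enorm (u - v).
Proof.
have := enorm_sub_le u v; have := enorm_sub_le v u.
by rewrite -(enormN (v - u)) opprB ler_norml => ? ?; apply/andP; split; lra.
Qed.

(** * Comparison with the sup norm, neighbourhoods and compact balls *)

Lemma norm_le_enorm (R : realType) (n : nat) (u : 'rV[R]_n) :
  `|u| <= enorm u.
Proof.
rewrite {1}/Num.norm/= mx_normrE; apply/bigmax_leP; split=> [|[i j] _ /=].
  exact: enorm_ge0.
rewrite (ord1 i) -(ler_pXn2r (n := 2)) ?nnegrE ?enorm_ge0// sqr_enorm.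
rewrite real_normK ?num_real// expr2 /dot (bigD1 j)//= lerDl.
by apply: sumr_ge0 => k _; rewrite -expr2 sqr_ge0.
Qed.

(** Summing over coordinates gives the factor [n] between the squares. The cruder [n.+1] between the
    norms stays positive for [n = 0], so that it can be divided by. *)
Lemma enorm_le_norm (R : realType) (n : nat) (u : 'rV[R]_n) :
  enorm u <= n.+1%:R * `|u|.
Proof.
rewrite -(ler_pXn2r (n := 2)) ?nnegrE ?mulr_ge0 ?enorm_ge0// sqr_enorm exprMn.
apply: (@le_trans _ _ (n%:R * `|u| ^+ 2)).
  have -> : n%:R * `|u| ^+ 2 = \sum_(i < n) `|u| ^+ 2.
    by rewrite sumr_const card_ord mulr_natl.
  apply: ler_sum => i _; rewrite -expr2 -[leLHS]real_normK ?num_real//.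
  rewrite lerXn2r ?nnegrE// [leRHS]/Num.norm/= mx_normrE.
  by apply/bigmax_geP; right => /=; exists (ord0, i).
apply: ler_wpM2r; first exact: sqr_ge0.
by rewrite -natrX ler_nat expnS expn1 mulSn; rewrite ltnW// ltnS leq_addr.
Qed.

(** Equivalence of the two norms, in the form used below: neighbourhoods are handled with the
    Euclidean distance, in which the balls and moduli of continuity are stated. *)
Lemma near_enormP (R : realType) (n : nat) (x : 'rV[R]_n)
    (P : 'rV[R]_n -> Prop) :
  (\forall y \near x, P y) <->
  exists2 e : R, 0 < e & forall y, enorm (y - x) < e -> P y.
Proof.
split=> [/nbhs_ballP[e/= e0 xe]|[e e0 xe]].
  exists e => // y yx; apply: xe; rewrite -ball_normE/= distrC.
  exact: le_lt_trans (norm_le_enorm _) yx.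
apply/nbhs_ballP; exists (e / n.+1%:R) => /=; first by rewrite divr_gt0.
move=> y; rewrite -ball_normE/= distrC ltr_pdivlMr// mulrC => yx.
exact/xe/(le_lt_trans (enorm_le_norm _)).
Qed.

Lemma continuous_edist (R : realType) (n : nat) (c : 'rV[R]_n) :
  continuous (fun x : 'rV[R]_n => enorm (x - c)).
Proof.
move=> x; apply/(@cvgrPdist_lt _ _ _ (nbhs x)) => e e0; apply/near_enormP.
exists e => // y yx; apply: le_lt_trans (enorm_dist_le _ _) _.
by rewrite opprB addrA subrK -enormN opprB.
Qed.

Lemma closed_enorm_le (R : realType) (n : nat) (c : 'rV[R]_n) (r : R) :
  closed [set x | enorm (x - c) <= r].
Proof.
apply: (@closed_comp _ _ (fun x : 'rV[R]_n => enorm (x - c)) [set t | t <= r]).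
  by move=> x _; exact: continuous_edist.
exact: closed_le.
Qed.

Lemma closure_eball_le (R : realType) (n : nat) (r : R) (x : 'rV[R]_n) :
  closure (eball r) x -> enorm x <= r.
Proof.
have sub : eball r `<=` [set x : 'rV[R]_n | enorm (x - 0) <= r].
  by move=> y; rewrite /eball/= subr0 => /ltW.
move=> /(closure_subset sub)/closed_enorm_le.
by rewrite /= subr0.
Qed.

Lemma compact_enorm_le (R : realType) (n : nat) (c : 'rV[R]_n) (r : R) :
  compact [set x | enorm (x - c) <= r].
Proof.
apply: bounded_closed_compact; last exact: closed_enorm_le.
exists (r + enorm c); split; first exact: num_real.
move=> M rM x /= xr; apply: le_trans (norm_le_enorm _) _.
have := enormD (x - c) c; rewrite subrK; lra.
Qed.

Lemma compact_closure_eball (R : realType) (n : nat) (r : R) :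
  compact (closure (@eball R n r)).
Proof.
apply: (subclosed_compact _ (@compact_enorm_le R n 0 r)).
  exact: closed_closure.
by move=> x /closure_eball_le; rewrite /= subr0.
Qed.

(** * Bounded uniformly continuous functions *)

Lemma BUC_within_continuous (R : realType) (n : nat) (A : set 'rV[R]_n)
    (v : 'rV[R]_n -> R) :
  BUC A v -> {within A, continuous v}.
Proof.
case=> _ uv; apply/subspace_continuousP => x Ax; apply/cvgrPdist_lt => e e0.
have [d d0 xd] := uv _ e0; rewrite near_withinE; apply/near_enormP.
by exists d => // y yx Ay; apply: xd => //; rewrite -enormN opprB.
Qed.

Lemma BUC_bound (R : realType) (n : nat) (A : set 'rV[R]_n)
    (v : 'rV[R]_n -> R) :
  BUC A v -> exists2 M, 0 <= M & forall x, A x -> `|v x| <= M.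
Proof.
case=> [[M [Mr vM]] _]; exists (Num.max 0 (M + 1)).
  by rewrite le_max lexx.
move=> x Ax; apply: vM => //.
by rewrite lt_max [X in _ || X]ltrDl ltr01 orbT.
Qed.

Lemma bounded_on_le (R : realType) (n : nat) (A : set 'rV[R]_n)
    (v : 'rV[R]_n -> R) (M : R) :
  (forall x, A x -> `|v x| <= M) -> [bounded v x | x in A].
Proof.
move=> vM; exists M; split; first exact: num_real.
by move=> N /ltW MN x Ax /=; exact: le_trans (vM x Ax) MN.
Qed.

Lemma BUC_sub (R : realType) (n : nat) (A B : set 'rV[R]_n)
    (v : 'rV[R]_n -> R) :
  A `<=` B -> BUC B v -> BUC A v.
Proof.
move=> AB /[dup]/BUC_bound[M _ vM] [_ uv]; split.
  by apply: (@bounded_on_le _ _ _ _ M) => x /AB/vM.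
move=> e e0; have [d d0 h] := uv e e0; exists d => // x y Ax Ay.
by apply: h; exact: AB.
Qed.

Lemma BUC_opp (R : realType) (n : nat) (A : set 'rV[R]_n) (v : 'rV[R]_n -> R) :
  BUC A v -> BUC A (\- v).
Proof.
move=> Av; have [M _ vM] := BUC_bound Av; case: Av => _ uv; split.
  by apply: (@bounded_on_le _ _ _ _ M) => x /vM; rewrite /= normrN.
move=> e e0; have [d d0 h] := uv e e0; exists d => // x y Ax Ay xy.
by rewrite /= -opprD normrN; exact: h.
Qed.

(** * One-sided derivatives along rays *)

Lemma near_line (R : realType) (n : nat) (x v : 'rV[R]_n)
    (P : 'rV[R]_n -> Prop) :
  (\forall y \near x, P y) -> \forall t \near (0 : R)^'+, P (x + t *: v).
Proof.
move=> /near_enormP[e e0 xe].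
(* The [+ 1] keeps the divisor positive when [v = 0]. *)
have v1 : 0 < enorm v + 1 by rewrite ltr_wpDl ?enorm_ge0.
near=> t; apply: xe; rewrite addrC addKr enormZ.
have t0 : 0 < t by near: t; exact: nbhs_right_gt.
have te : t < e / (enorm v + 1).
  by near: t; apply: nbhs_right_lt; rewrite divr_gt0.
rewrite gtr0_norm//; move: te; rewrite ltr_pdivlMr// => te.
by apply: le_lt_trans te; rewrite ler_pM2l// lerDl.
Unshelve. all: by end_near. Qed.

(** A derivative is the limit of its right difference quotients, so comparing increments for [t > 0]
    suffices. Later [g] follows a bound on [enorm (x + t *: v)] that is only available on that
    side. *)
Lemma derive_le_right (R : realType) (n : nat) (phi : 'rV[R]_n -> R)
    (x v : 'rV[R]_n) (g : R -> R) (d : R) :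
  derivable phi x v -> is_derive (0 : R) 1 g d ->
  (\forall t \near (0 : R)^'+, phi (x + t *: v) - phi x <= g t - g 0) ->
  'D_v phi x <= d.
Proof.
move=> dphi [dg <-] phig.
have phic :
    h^-1 *: (phi (h *: v + x) - phi x) @[h --> (0 : R)^'+] --> 'D_v phi x.
  exact: cvg_dnbhs_at_right dphi.
have gc : h^-1 *: (g (h *: 1 + 0) - g 0) @[h --> (0 : R)^'+] --> 'D_1 g 0.
  exact: cvg_dnbhs_at_right dg.
apply: (ler_cvg_to phic gc); near=> t.
have t0 : 0 < t by near: t; exact: nbhs_right_gt.
have : phi (x + t *: v) - phi x <= g t - g 0 by near: t.
rewrite [x + _]addrC.
rewrite (_ : t *: 1 + 0 = t); last by rewrite addr0 /GRing.scale/= mulr1.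
by rewrite !(_ : forall a b : R, a *: b = a * b)// ler_pM2l ?invr_gt0.
Unshelve. all: by end_near. Qed.

Lemma dot_grad (R : realType) (n : nat) (phi : 'rV[R]_n -> R)
    (x v : 'rV[R]_n) :
  differentiable phi x -> dot (grad phi x) v = 'D_v phi x.
Proof.
move=> dphi; rewrite deriveE// [in RHS](row_sum_delta v) linear_sum.
apply: eq_bigr => i _; rewrite mxE deriveE// mulrC.
by rewrite linearZ.
Qed.

Lemma dot_grad_le (R : realType) (n : nat) (phi : 'rV[R]_n -> R)
    (x v : 'rV[R]_n) (g : R -> R) (d : R) :
  differentiable phi x -> is_derive (0 : R) 1 g d ->
  (\forall t \near (0 : R)^'+, phi (x + t *: v) - phi x <= g t - g 0) ->
  dot (grad phi x) v <= d.
Proof.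
by move=> dphi dg phig; rewrite dot_grad//; apply: derive_le_right dg phig;
   exact: diff_derivable.
Qed.

(** * Radial test functions and touching paraboloids *)

Definition sqdist {R : realType} {n : nat} (c x : 'rV[R]_n) : R :=
  dot (x - c) (x - c).

Lemma sqdist_ge0 (R : realType) (n : nat) (c x : 'rV[R]_n) : 0 <= sqdist c x.
Proof. exact: dotvv_ge0. Qed.

Lemma differentiable_sqdist (R : realType) (n : nat) (c x : 'rV[R]_n) :
  differentiable (sqdist c) x.
Proof.
rewrite (_ : sqdist c = \sum_(i < n)
    ((fun y : 'rV[R]_n => y ord0 i - c ord0 i) *
     (fun y => y ord0 i - c ord0 i)) :> ('rV[R]_n -> R)); last first.
  apply/funext => y; rewrite fct_sumE; apply: eq_bigr => i _.
  by rewrite !mxE.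
apply: differentiable_sum => i.
have dx : differentiable (fun y : 'rV[R]_n => y ord0 i - c ord0 i) x.
  apply: differentiableB; last exact: differentiable_cst.
  exact: differentiable_coord.
exact: differentiableM.
Qed.

Lemma derive_sqdist (R : realType) (n : nat) (c x v : 'rV[R]_n) :
  'D_v (sqdist c) x = 2 * dot (x - c) v.
Proof.
apply: cvg_lim => //.
(* For [h] different from 0 this is exactly the difference quotient. *)
have c1 : 2 * dot (x - c) v + h * dot v v @[h --> (0 : R)^'] -->
    2 * dot (x - c) v + 0 * dot v v.
  apply: cvgD; first exact: cvg_cst.
  by apply: cvgMr_tmp; apply: nbhs_dnbhs.
rewrite mul0r addr0 in c1; apply: cvg_trans c1; apply: near_eq_cvg.
near=> h; have h0 : h != 0 by near: h; exact: nbhs_dnbhs_neq.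
rewrite /= /sqdist -addrA !(dotDl (h *: v)) !(dotDr _ (h *: v)) !(dotZl, dotZr).
rewrite (dotC v (x - c)) /GRing.scale/=; field; exact: h0.
Unshelve. all: by end_near. Qed.

(** Composing with the squared distance avoids the singularity of the distance at [c]. As [sqdist]
    is nonnegative, [f] is only asked to be differentiable at nonnegative arguments, which admits
    profiles containing a square root. *)
Lemma differentiable_radial (R : realType) (n : nat) (f df : R -> R)
    (c x : 'rV[R]_n) :
  (forall t : R, 0 <= t -> is_derive t 1 f (df t)) ->
  differentiable (f \o sqdist c) x.
Proof.
move=> fdf; apply: differentiable_comp; first exact: differentiable_sqdist.
by apply/derivable1_diffP; have [] := fdf _ (sqdist_ge0 c x).
Qed.

Lemma grad_radial (R : realType) (n : nat) (f df : R -> R) (c x : 'rV[R]_n) :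
  (forall t : R, 0 <= t -> is_derive t 1 f (df t)) ->
  grad (f \o sqdist c) x = (2 * df (sqdist c x)) *: (x - c).
Proof.
move=> fdf; apply/rowP => i; rewrite mxE.
have [df1 dfE] := fdf _ (sqdist_ge0 c x); move/derivable1_diffP : (df1) => dff.
rewrite deriveE; last exact: differentiable_radial fdf.
rewrite diff_comp//; last exact: differentiable_sqdist.
rewrite /= -(deriveE _ (differentiable_sqdist c x)) derive_sqdist.
(* By linearity, the differential of [f] at [s] is [s] times its value at 1, that is, [s] times the
   derivative of [f]. *)
set s := 2 * _; rewrite -[s](_ : s *: (1 : R) = s); last exact: mulr1.
rewrite linearZ/= -deriveE// dfE mxE /s.
rewrite (_ : forall a b : R, a *: b = a * b)//.
suff -> : dot (x - c) (delta_mx ord0 i) = (x - c) ord0 i by ring.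
rewrite dotC /dot (bigD1 i)//= [delta_mx _ _ _ _]mxE !eqxx mul1r big1 ?addr0//.
by move=> j ji; rewrite mxE (negbTE ji) andbF mul0r.
Qed.

Lemma C1_on_radial (R : realType) (n : nat) (A : set 'rV[R]_n) (f df : R -> R)
    (c : 'rV[R]_n) :
  (forall t : R, 0 <= t -> is_derive t 1 f (df t)) ->
  (forall t : R, 0 <= t -> {for t, continuous df}) ->
  C1_on A (f \o sqdist c).
Proof.
move=> fdf cdf; exists setT; split=> //; first exact: openT.
  by move=> x _; exact: differentiable_radial fdf.
move=> x _; rewrite (_ : grad (f \o sqdist c) =
    (fun x => (2 * df (sqdist c x)) *: (x - c))); last first.
  by apply/funext => y; exact: grad_radial.
apply: (@cvgZ _ _ _ (nbhs x)); last first.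
  by apply: cvgB; [exact: cvg_id|exact: cvg_cst].
apply: (@cvgM _ _ (nbhs x)); first exact: cvg_cst.
apply: (@continuous_comp _ _ _ (sqdist c) df).
  exact/differentiable_continuous/differentiable_sqdist.
exact/cdf/sqdist_ge0.
Qed.

Lemma is_derive_mulr (R : realType) (N t : R) : is_derive t 1 ( *%R N) N.
Proof. by apply: is_derive_eq; rewrite -[RHS]mulr1. Qed.

Lemma C1_on_quad (R : realType) (n : nat) (A : set 'rV[R]_n) (N : R)
    (c : 'rV[R]_n) :
  C1_on A (fun y => N * sqdist c y).
Proof.
apply: (@C1_on_radial _ _ _ ( *%R N) (cst N)) => t _.
  exact: is_derive_mulr.
exact: cvg_cst.
Qed.

Lemma grad_quad (R : realType) (n : nat) (N : R) (c x : 'rV[R]_n) :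
  grad (fun y => N * sqdist c y) x = (2 * N) *: (x - c).
Proof.
exact: (@grad_radial _ _ ( *%R N) (cst N) c x (fun t _ => is_derive_mulr N t)).
Qed.

(** Maximize [v - N |y - c|^2] over the closed ball with [N r^2 = 2 M + 1]. On the sphere the
    penalty exceeds the largest possible oscillation [2 M] of [v], so the maximum is interior;
    comparison with the centre gives [v c <= v z]. The slope of the paraboloid is at most [2 N r],
    hence small when [r] is large. *)
Lemma quad_touching (R : realType) (n : nat) (A : set 'rV[R]_n)
    (v : 'rV[R]_n -> R) (c : 'rV[R]_n) (r M : R) :
  0 < r -> BUC A v -> 0 <= M -> (forall x, A x -> `|v x| <= M) ->
  (forall y, enorm (y - c) <= r -> A y) ->
  exists z N, [/\ enorm (z - c) < r, v c <= v z,
    `|2 * N| * enorm (z - c) <= 2 * (2 * M + 1) / r &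
    \forall y \near z, v y - N * sqdist c y <= v z - N * sqdist c z].
Proof.
move=> r0 Av M0 vM ballA; pose N := (2 * M + 1) / r ^+ 2.
have N0 : 0 < N by rewrite divr_gt0 ?exprn_gt0//; lra.
pose K := [set y | enorm (y - c) <= r].
have cK : K c by rewrite /K/= subrr enorm0 ltW.
have vK : {within K, continuous (fun y => v y - N * sqdist c y)}.
  have vc := BUC_within_continuous (BUC_sub ballA Av).
  apply/subspace_continuousP => y Ky.
  move/subspace_continuousP : vc => /(_ y Ky) vc.
  apply: cvgB vc _; apply: cvgM; first exact: cvg_cst.
  apply: cvg_within_filter.
  exact/differentiable_continuous/differentiable_sqdist.
have [z /[!inE] Kz zmax] :=
  EVT_max_rV (ex_intro _ c cK) (@compact_enorm_le R n c r) vK.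
have := zmax c; rewrite inE => /(_ cK).
have -> : sqdist c c = 0 by rewrite /sqdist -sqr_enorm subrr enorm0 expr0n.
rewrite mulr0 subr0 => vcz.
have qz0 : 0 <= N * sqdist c z by rewrite mulr_ge0 ?sqdist_ge0 ?ltW.
have vc : - M <= v c by have := vM c (ballA _ cK); rewrite ler_norml => /andP[].
have vz : v z <= M by have := vM z (ballA _ Kz); rewrite ler_norml => /andP[].
have zr : enorm (z - c) < r.
  rewrite -(ltr_pXn2r (n := 2)) ?nnegrE ?enorm_ge0// ?ltW// sqr_enorm.
  rewrite -(ltr_pM2l N0) [N * r ^+ 2]divfK ?gt_eqF ?exprn_gt0//.
  move: qz0 vcz; rewrite /sqdist; lra.
exists z, N; split => //; first lra.
- rewrite ger0_norm; last by rewrite mulr_ge0 ?ltW.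
  apply: (@le_trans _ _ (2 * N * r)).
    by apply: ler_wpM2l (ltW zr); rewrite mulr_ge0// ltW.
  by rewrite /N le_eqVlt; apply/orP; left; apply/eqP; field; rewrite gt_eqF.
- apply/near_enormP; exists (r - enorm (z - c)); first by rewrite subr_gt0.
  move=> y yz; apply: zmax; rewrite inE /K/=.
  have := enormD (y - z) (z - c); rewrite addrA subrK; lra.
Qed.

(** * Bounds on the Hamiltonian *)

Lemma locally_lipschitz_at (R : realType) (n : nat) (H : 'rV[R]_n -> R)
    (p : 'rV[R]_n) :
  locally_lipschitz H -> exists L d : R, [/\ 0 < L, 0 < d &
    forall q, enorm (q - p) < d -> `|H q - H p| <= L * enorm (q - p)].
Proof.
move=> /(_ p)[U Up [M [_ HM]]].
have [d d0 dU] := (near_enormP p U).1 Up.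
(* The Lipschitz bound is given for every constant strictly above [M], and [M] may be negative. *)
pose L := Num.max 1 (M + 1).
exists L, d; split=> //; first by rewrite lt_max ltr01.
move=> q /dU Uq.
have ML : M < L by rewrite lt_max ltrDl ltr01 orbT.
have := HM L ML (q, p); rewrite /= => /(_ (conj Uq (nbhs_singleton Up))).
move=> /le_trans; apply; rewrite ler_pM2l ?norm_le_enorm//.
by rewrite lt_max ltr01.
Qed.

Lemma locally_lipschitz_continuous (R : realType) (n : nat)
    (H : 'rV[R]_n -> R) :
  locally_lipschitz H -> continuous H.
Proof.
move=> HL p; have [L [d [L0 d0 h]]] := locally_lipschitz_at p HL.
apply/(@cvgrPdist_lt _ _ _ (nbhs p)) => e e0; apply/near_enormP.
exists (Num.min d (e / L)); first by rewrite lt_min d0 divr_gt0.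
move=> q; rewrite lt_min => /andP[/h qp qe]; rewrite distrC.
by apply: le_lt_trans qp _; rewrite mulrC -ltr_pdivlMr.
Qed.

(** Being continuous and coercive, [H] is bounded below, by [H 0 - m] say. The conical bound follows
    from the Lipschitz estimate on [|p| < d], and from [m <= (m / d) |p|] elsewhere. A single [C]
    serves both bounds. *)
Lemma coercive_lower_bound (R : realType) (n : nat) (H : 'rV[R]_n -> R) :
  locally_lipschitz H -> coercive H ->
  exists2 C : R, 0 < C &
    forall p, H 0 - C <= H p /\ H 0 - C * enorm p <= H p.
Proof.
move=> HL Hco; have [r rH] := Hco (H 0).
have [m m0 Hm] : exists2 m : R, 0 <= m & forall p, H 0 - m <= H p.
  (* The maximum with 0 puts the origin in the ball, so that the minimum of [H] there is at most
     [H 0], hence also a lower bound outside the ball. *)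
  have r0 : [set p : 'rV[R]_n | enorm (p - 0) <= Num.max 0 r] 0.
    by rewrite /= subrr enorm0 le_max lexx.
  have Hw : {within [set p : 'rV[R]_n | enorm (p - 0) <= Num.max 0 r],
      continuous H}.
    exact/continuous_subspaceT/locally_lipschitz_continuous.
  have [q /[!inE] _ qmin] :=
    EVT_min_rV (ex_intro _ _ r0) (@compact_enorm_le R n 0 _) Hw.
  have q0 : H q <= H 0 by apply: qmin; rewrite inE.
  exists (H 0 - H q) => [|p]; first by rewrite subr_ge0.
  have [pr|rp] := lerP (enorm p) (Num.max 0 r).
    by rewrite opprB addrC subrK; apply: qmin; rewrite inE/= subr0.
  rewrite opprB addrC subrK (le_trans q0)// rH//.
  by apply: le_lt_trans rp; rewrite le_max lexx orbT.
have [L [d [L0 d0 Hd]]] := locally_lipschitz_at 0 HL.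
have md0 : 0 <= m / d by rewrite divr_ge0 // ltW.
exists (L + m / d + m) => [|p]; first by rewrite -addrA ltr_wpDr ?addr_ge0.
split; first by have := Hm p; lra.
have p0 := enorm_ge0 p.
have [pd|dp] := ltrP (enorm p) d.
  have := Hd p; rewrite subr0 => /(_ pd); rewrite ler_norml => /andP[+ _].
  have : 0 <= (m / d + m) * enorm p by rewrite mulr_ge0// addr_ge0.
  lra.
have := Hm p; have : m <= m / d * enorm p.
  by rewrite mulrAC -mulrA ler_peMr// ler_pdivlMr// mul1r.
have : 0 <= (L + m) * enorm p by rewrite mulr_ge0// addr_ge0// ltW.
lra.
Qed.

(** * The solution on the whole space *)

Lemma whole_space_solution (R : realType) (n : nat) (H u : 'rV[R]_n -> R) :
  locally_lipschitz H -> state_constraint_solution H setT u ->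
  forall x, u x = - H 0.
Proof.
move=> HL [[uB usub] [_ usup]] x; rewrite closureT in usup.
have [L [d [L0 d0 Hd]]] := locally_lipschitz_at 0 HL.
suff h e : 0 < e -> u x <= - H 0 + e /\ - H 0 <= u x + e.
  by apply/eqP; rewrite eq_le; apply/andP; split; apply/ler_addgt0Pr => e /h[].
move=> e0; have [M M0 uM] := BUC_bound uB.
pose s := Num.min d (e / L); have s0 : 0 < s by rewrite lt_min d0 divr_gt0.
(* On the whole space the touching radius is unrestricted. This choice makes the slope bound
   [s / 2], and for gradients below [s] the value of [H] is within [e] of [H 0]. *)
pose r := 4 * (2 * M + 1) / s.
have r0 : 0 < r by rewrite divr_gt0//; lra.
have small : 2 * (2 * M + 1) / r < s.
  rewrite ltr_pdivrMr// [s * r]mulrC divfK ?gt_eqF//; lra.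
have Hs p : enorm p < s -> `|H p - H 0| <= e.
  rewrite lt_min => /andP[pd pe]; have := Hd p; rewrite subr0 => /(_ pd).
  by move=> /le_trans; apply; rewrite mulrC -ler_pdivlMr// ltW.
split.
- have [z [N [_ uz Nz zmax]]] :=
    @quad_touching _ _ setT u x r M r0 uB M0 uM (fun _ _ => I).
  have := usub z _ I (C1_on_quad setT N x).
  rewrite grad_quad => /(_ (filterS (fun _ h _ => h) zmax)).
  have := Hs ((2 * N) *: (z - x)); rewrite enormZ.
  move=> /(_ (le_lt_trans Nz small)).
  rewrite ler_norml => /andP[]; lra.
(* Touching [- u] from above is touching [u] from below, with the paraboloid of coefficient
   [- N]. *)
- have uM' y : setT y -> `|(\- u) y| <= M by move=> /uM; rewrite normrN.
  have [z [N [_ uz Nz zmax]]] :=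
    @quad_touching _ _ setT (\- u) x r M r0 (BUC_opp uB) M0 uM' (fun _ _ => I).
  have := usup z _ I (C1_on_quad setT (- N) x).
  rewrite grad_quad mulrN => /(_ _)/wrap[].
    by apply: filterS zmax => y /= h _; lra.
  have := Hs (- (2 * N) *: (z - x)); rewrite enormZ normrN.
  move=> /(_ (le_lt_trans Nz small)); rewrite ler_norml => /andP[].
  rewrite /= in uz; lra.
Qed.

(** * Lower and crude upper bounds on the ball *)

Lemma eball_supersolution_ge (R : realType) (n : nat) (H u : 'rV[R]_n -> R)
    (k : R) :
  viscosity_supersolution H (eball k) u ->
  forall x, closure (eball k) x -> - H 0 <= u x.
Proof.
move=> [uB usup] x xk.
(* The minimum may lie on the sphere; the state constraint makes the supersolution test valid there
   too. The test function is the paraboloid of coefficient 0. *)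
have [z /[!inE] zk zmin] := EVT_min_rV (ex_intro _ x xk)
  (@compact_closure_eball R n k) (BUC_within_continuous uB).
have := usup z _ zk (C1_on_quad _ 0 0); rewrite grad_quad mulr0 scale0r.
move=> /(_ _)/wrap[].
  apply/near_enormP; exists 1 => // y _ yk; rewrite !mul0r !subr0.
  by apply: zmin; rewrite inE.
have : u z <= u x by apply: zmin; rewrite inE.
lra.
Qed.

(** A test function touching at [x] itself need not exist, but a paraboloid touches at some [z] with
    [u x <= u z]. Its slope is irrelevant, since the lower bound on [H] holds for all gradients. *)
Lemma eball_subsolution_le (R : realType) (n : nat) (H u : 'rV[R]_n -> R)
    (k m : R) :
  (forall p, H 0 - m <= H p) ->
  viscosity_subsolution H (eball k) u ->
  forall x, eball k x -> u x <= m - H 0.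
Proof.
move=> Hm [uB usub] x xk.
have [M M0 uM] := BUC_bound uB; pose r := (k - enorm x) / 2.
have r0 : 0 < r by rewrite divr_gt0// subr_gt0.
have ballk y : enorm (y - x) <= r -> eball k y.
  move: r0; rewrite /r /eball/=; have := enormD (y - x) x; rewrite subrK; lra.
have [z [N [zr uz _ zmax]]] := quad_touching r0 uB M0 uM ballk.
have := usub z _ (ballk z (ltW zr)) (C1_on_quad _ N x).
move=> /(_ (filterS (fun _ h _ => h) zmax)).
have := Hm (grad (fun y => N * sqdist x y) z); lra.
Qed.

(** Carries upper bounds to the sphere, where the subsolution property says nothing. *)
Lemma BUC_closure_le (R : realType) (n : nat) (A : set 'rV[R]_n)
    (u : 'rV[R]_n -> R) (m : R) :
  BUC (closure A) u -> (forall x, A x -> u x <= m) ->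
  forall x, closure A x -> u x <= m.
Proof.
move=> [_ uu] um x xA; apply/ler_addgt0Pr => e e0; have [d d0 ud] := uu e e0.
have /xA[y [Ay yx]] : nbhs x [set y | enorm (y - x) < d].
  by apply/near_enormP; exists d.
have := ud y x (subset_closure Ay) xA yx; rewrite ltr_norml => /andP[+ _].
have := um y Ay; lra.
Qed.

(** * The exponential upper barrier *)

Lemma is_derive_barrier (R : realType) (C k e t : R) :
  0 < C -> 0 < e -> 0 <= t ->
  is_derive t 1 (fun s => C * expR ((Num.sqrt (s + e) - k) / C))
    (expR ((Num.sqrt (t + e) - k) / C) / (2 * Num.sqrt (t + e))).
Proof.
move=> C0 e0 t0; have te : 0 < t + e by rewrite ltr_wpDl.
have ds : is_derive t 1 (fun s => Num.sqrt (s + e)) (2 * Num.sqrt (t + e))^-1.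
  rewrite -[X in is_derive _ _ _ X]mulr1.
  apply: (@is_derive1_comp _ Num.sqrt (fun s => s + e)).
    exact: is_derive1_sqrt.
  by apply: is_derive_eq; rewrite addr0.
have de : is_derive t 1 (fun s => (Num.sqrt (s + e) - k) / C)
    ((2 * Num.sqrt (t + e))^-1 / C).
  have -> : (fun s => (Num.sqrt (s + e) - k) / C) =
    (fun s => C^-1 *: (Num.sqrt (s + e) - k)).
    by apply/funext => s; rewrite mulrC.
  by apply: is_derive_eq; rewrite subr0 [RHS]mulrC.
have dx : is_derive t 1 (fun s => expR ((Num.sqrt (s + e) - k) / C))
    (expR ((Num.sqrt (t + e) - k) / C) * ((2 * Num.sqrt (t + e))^-1 / C)).
  exact: (@is_derive1_comp _ expR _ _ _ _ (is_derive_expR _) de).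
apply: is_derive_eq.
rewrite (_ : forall a b : R, a *: b = a * b)// mulrCA; congr (_ * _).
by rewrite mulrC divfK// gt_eqF.
Qed.

Lemma continuous_barrier_derivative (R : realType) (C k e t : R) :
  0 < e -> 0 <= t ->
  {for t, continuous (fun t =>
    expR ((Num.sqrt (t + e) - k) / C) / (2 * Num.sqrt (t + e)))}.
Proof.
move=> e0 t0; have te : 0 < t + e by rewrite ltr_wpDl.
have sc : Num.sqrt (s + e) @[s --> t] --> Num.sqrt (t + e).
  apply: (@continuous_comp _ _ _ (fun s => s + e) Num.sqrt).
    by apply: cvgD; [exact: cvg_id|exact: cvg_cst].
  exact: sqrt_continuous.
apply: cvgM.
  apply: (@continuous_comp _ _ _ (fun s => (Num.sqrt (s + e) - k) / C) expR).
    apply: cvgM; last exact: cvg_cst.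
    by apply: cvgB; [exact: sc|exact: cvg_cst].
  exact: continuous_expR.
apply: cvgV; first by rewrite mulf_neq0 ?gt_eqF ?sqrtr_gt0.
by apply: cvgM; [exact: cvg_cst|exact: sc].
Qed.

(* [C expR ((|x| - k) / C)] solves [w = C |Dw|] but has a kink at [0];
   replacing [|x|] by [sqrt (|x|^2 + e)] makes it a C^1 strict supersolution
   of that equation. *)
Lemma eball_solution_le_barrier (R : realType) (n : nat) (H u : 'rV[R]_n -> R)
    (C k e : R) (x : 'rV[R]_n) :
  0 < C -> (forall p, H 0 - C <= H p /\ H 0 - C * enorm p <= H p) ->
  state_constraint_solution H (eball k) u -> 0 < e -> closure (eball k) x ->
  u x + H 0 <= C * expR ((Num.sqrt (enorm x ^+ 2 + e) - k) / C).
Proof.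
move=> C0 HC [sub [uB _]] e0 xk.
pose f s := C * expR ((Num.sqrt (s + e) - k) / C).
have fdf (s : R) : 0 <= s -> is_derive s 1 f
    (expR ((Num.sqrt (s + e) - k) / C) / (2 * Num.sqrt (s + e))).
  exact: is_derive_barrier.
have fE y : f (sqdist 0 y) = C * expR ((Num.sqrt (enorm y ^+ 2 + e) - k) / C).
  by rewrite /f /sqdist subr0 sqr_enorm.
rewrite -fE.
have uk : {within closure (eball k),
    continuous (fun y => u y - (f \o sqdist 0) y)}.
  apply/subspace_continuousP => y yk.
  move/subspace_continuousP : (BUC_within_continuous uB) => /(_ y yk) uc.
  apply: cvgB uc _; apply: cvg_within_filter.
  exact/differentiable_continuous/(differentiable_radial _ _ fdf).
have [z /[!inE] zk zmax] := EVT_max_rV (ex_intro _ x xk)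
  (@compact_closure_eball R n k) uk.
have := zmax x; rewrite inE => /(_ xk) /=.
(* Maximality of [z] transfers the comparison from [z] to [x]. *)
suff : u z + H 0 <= f (sqdist 0 z) by lra.
(* On the sphere the crude bound [C] is enough, because the barrier is at least [C] where
   [|z| >= k]. Inside, the barrier is an admissible test function at [z]. *)
have [zint|kz] := ltP (enorm z) k; last first.
  have uz : u z <= C - H 0.
    apply: (BUC_closure_le uB _ zk) => y yk.
    exact: eball_subsolution_le (fun p => (HC p).1) sub _ yk.
  apply: (@le_trans _ _ C); first lra.
  rewrite fE ler_peMr ?(ltW C0)// -[leLHS]expR0 ler_expR.
  rewrite divr_ge0 ?(ltW C0)// subr_ge0.
  apply: le_trans kz _; rewrite -[leLHS]ger0_norm ?enorm_ge0// -sqrtr_sqr.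
  by rewrite ler_wsqrtr// lerDl ltW.
have := sub.2 z _ zint (C1_on_radial (eball k) 0 fdf
  (fun t t0 => @continuous_barrier_derivative _ C k _ _ e0 t0)).
rewrite (grad_radial _ _ fdf) subr0 => /(_ _)/wrap[].
  apply/near_enormP; exists 1 => // y _ yk; apply: zmax.
  by rewrite inE; exact: subset_closure.
set a := expR _; set p := _ *: z.
(* The gradient has norm [a |z| / sqrt (|z|^2 + e)], while the barrier equals [C a]. So [C |p|] is
   at most the barrier, and the conical bound on [H] concludes. *)
have pa : enorm p <= a.
  rewrite /p enormZ ger0_norm; last first.
    by rewrite mulr_ge0// divr_ge0 ?expR_ge0// mulr_ge0 ?sqrtr_ge0.
  have S0 : 0 < Num.sqrt (sqdist 0 z + e).
    by rewrite sqrtr_gt0 ltr_wpDl// sqdist_ge0.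
  have -> : 2 * (a / (2 * Num.sqrt (sqdist 0 z + e))) * enorm z =
      a * (enorm z / Num.sqrt (sqdist 0 z + e)) by field; rewrite gt_eqF.
  rewrite ler_piMr ?expR_ge0// ler_pdivrMr// mul1r.
  by rewrite enormE ler_wsqrtr// /sqdist subr0 lerDl ltW.
have [_ Hp] := HC p.
have : C * enorm p <= C * a by rewrite ler_pM2l.
rewrite /f -/a; lra.
Qed.

(** The smoothing is removed by taking the parameter [e ^+ 2]: since
    [sqrt (|x|^2 + e^2) <= |x| + e], the bound is continuous in [e] and passes to the limit
    [e -> 0]. *)
Lemma eball_solution_le (R : realType) (n : nat) (H u : 'rV[R]_n -> R)
    (C k : R) (x : 'rV[R]_n) :
  0 < C -> (forall p, H 0 - C <= H p /\ H 0 - C * enorm p <= H p) ->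
  state_constraint_solution H (eball k) u -> closure (eball k) x ->
  u x + H 0 <= C * expR (enorm x / C) * expR (- (k / C)).
Proof.
move=> C0 HC ksol xk; rewrite -mulrA -expRD -mulrBl.
have h e : 0 < e -> u x + H 0 <= C * expR ((enorm x + e - k) / C).
  move=> e0; have e20 := exprn_gt0 2 e0.
  apply: le_trans (eball_solution_le_barrier C0 HC ksol e20 xk) _.
  rewrite ler_pM2l// ler_expR ler_pM2r ?invr_gt0// lerD2r.
  have xe : 0 <= enorm x + e by rewrite addr_ge0 ?enorm_ge0// ltW.
  rewrite -[leRHS]ger0_norm// -sqrtr_sqr ler_wsqrtr// sqrrD lerD2r lerDl.
  by rewrite mulrn_wge0// mulr_ge0 ?enorm_ge0// ltW.
have lim : C * expR ((enorm x + e - k) / C) @[e --> (0 : R)^'+] -->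
    C * expR ((enorm x + 0 - k) / C).
  apply: cvg_at_right_filter; apply: cvgM; first exact: cvg_cst.
  apply: (@continuous_comp _ _ _ (fun e => (enorm x + e - k) / C) expR).
    apply: cvgM; last exact: cvg_cst.
    apply: cvgB; last exact: cvg_cst.
    by apply: cvgD; [exact: cvg_cst|exact: cvg_id].
  exact: continuous_expR.
rewrite addr0 in lim; apply: (cvgr_to_ge lim).
by near=> e; apply: h; near: e; exact: nbhs_right_gt.
Unshelve. all: by end_near. Qed.

(** * Optimality: the explicit example *)

Lemma dot_grad_ge (R : realType) (n : nat) (phi : 'rV[R]_n -> R)
    (x v : 'rV[R]_n) (g : R -> R) (d : R) :
  differentiable phi x -> is_derive (0 : R) 1 g d ->
  (\forall t \near (0 : R)^'+, g t - g 0 <= phi (x + t *: v) - phi x) ->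
  d <= dot (grad phi x) v.
Proof.
move=> dphi dg phig; have derphi := diff_derivable (v := v) dphi.
rewrite dot_grad// -lerN2 -deriveN//.
apply: (@derive_le_right _ _ _ _ _ (- g)); first exact: derivableN.
apply: filterS phig => t /=; rewrite !fctE; lra.
Qed.

Definition ring_well {R : realType} {n : nat} (C : R) (p : 'rV[R]_n) : R :=
  C * (`|enorm p - 1| - 1).

Definition exp_profile {R : realType} {n : nat} (C k : R) (x : 'rV[R]_n) : R :=
  C * expR ((enorm x - k) / C).

Lemma ring_well0 (R : realType) (n : nat) (C : R) :
  ring_well C (0 : 'rV[R]_n) = 0.
Proof. by rewrite /ring_well enorm0 sub0r normrN1 subrr mulr0. Qed.

Lemma ring_well_ge (R : realType) (n : nat) (C : R) (p : 'rV[R]_n) :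
  0 < C -> - C <= ring_well C p.
Proof.
move=> C0; have : 0 <= C * `|enorm p - 1| by rewrite mulr_ge0// ltW.
by rewrite /ring_well mulrBr mulr1; lra.
Qed.

Lemma ring_well_in (R : realType) (n : nat) (C : R) (p : 'rV[R]_n) :
  enorm p <= 1 -> ring_well C p = - (C * enorm p).
Proof. by move=> p1; rewrite /ring_well ler0_norm ?subr_le0//; ring. Qed.

Lemma locally_lipschitz_ring_well (R : realType) (n : nat) (C : R) :
  0 < C -> locally_lipschitz (@ring_well R n C).
Proof.
move=> C0 p; exists setT; first exact: filterT.
exists (C * n.+1%:R); split; first exact: num_real.
move=> M /ltW CM [q r] _ /=.
apply: (@le_trans _ _ (C * n.+1%:R * `|q - r|)); last exact: ler_wpM2r.
rewrite /ring_well -mulrBr normrM gtr0_norm// -mulrA ler_pM2l//.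
rewrite opprB addrA subrK; apply: le_trans (enorm_le_norm _).
apply: le_trans (enorm_dist_le _ _).
apply: le_trans (ler_dist_dist _ _) _.
by rewrite opprB addrA subrK.
Qed.

Lemma coercive_ring_well (R : realType) (n : nat) (C : R) :
  0 < C -> coercive (@ring_well R n C).
Proof.
move=> C0 M; exists (M / C + 2) => p pM.
rewrite /ring_well mulrC -ler_pdivrMr//.
have := ler_norm (enorm p - 1); lra.
Qed.

(** Where [phi] touches 0 it has a local extremum. Moving along the gradient, or against it for a
    minimum, gives [|D phi|^2 <= 0], so [ring_well] is evaluated at 0. *)
Lemma state_constraint_zero (R : realType) (n : nat) (C : R) :
  state_constraint_solution (@ring_well R n C) setT (fun=> 0).
Proof.
have B : BUC setT (fun _ : 'rV[R]_n => 0 : R).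
  split; first by apply: (@bounded_on_le _ _ _ _ 0) => x _; rewrite normr0.
  by move=> e e0; exists 1 => // x y _ _ _; rewrite subrr normr0.
have d0 : is_derive (0 : R) 1 (fun _ : R => 0 : R) (0 : R).
  exact: is_derive_cst.
have E (p : 'rV[R]_n) : enorm p ^+ 2 <= 0 -> ring_well C p = 0 :> R.
  move=> p0; suff -> : p = 0 :> 'rV[R]_n by exact: ring_well0.
  by apply: enorm_eq0; apply/eqP; rewrite -sqrf_eq0 eq_le p0 sqr_ge0.
split; split; rewrite ?closureT// => x phi _ [U [_ /(_ x I) Ux dphi _]] ext.
- rewrite add0r E//.
  have := @dot_grad_ge _ _ phi x (- grad phi x) _ _ (dphi _ Ux) d0.
  rewrite -(scaleN1r (grad phi x)) dotZr -sqr_enorm => /(_ _)/wrap[]; last lra.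
  have /(near_line (- grad phi x)) := ext; rewrite -(scaleN1r (grad phi x)).
  by apply: filterS => t /(_ I); lra.
- rewrite add0r E//.
  have := @dot_grad_le _ _ phi x (grad phi x) _ _ (dphi _ Ux) d0.
  rewrite -sqr_enorm => /(_ _)/wrap[]; last by [].
  have /(near_line (grad phi x)) := ext.
  by apply: filterS => t /(_ I); lra.
Qed.

(** For [a <= b], the difference is [expR b * (1 - expR (a - b))]; then [expR t >= 1 + t] and
    [expR b <= 1] conclude. *)
Lemma expR_lipschitz_neg (R : realType) (a b : R) :
  a <= 0 -> b <= 0 -> `|expR a - expR b| <= `|a - b|.
Proof.
wlog ab : a b / a <= b => [hw a0 b0|_ b0].
  have [|/ltW] := leP a b; first by move=> ?; exact: hw.
  by rewrite distrC (distrC a); move=> ?; exact: hw.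
rewrite distrC (distrC a) ger0_norm ?subr_ge0 ?ler_expR// ger0_norm ?subr_ge0//.
have -> : expR a = expR b * expR (a - b) by rewrite -expRD addrC subrK.
have e1 := expR_ge1Dx (a - b).
have b1 : expR b <= 1 by rewrite -expR0 ler_expR.
have be : expR b * (1 + (a - b)) <= expR b * expR (a - b).
  by rewrite ler_pM2l// expR_gt0.
have : expR b * (b - a) <= 1 * (b - a) by rewrite ler_wpM2r// subr_ge0.
lra.
Qed.

Lemma BUC_exp_profile (R : realType) (n : nat) (C k : R) : 0 < C ->
  BUC [set x : 'rV[R]_n | enorm x <= k] (exp_profile C k).
Proof.
move=> C0; have neg (x : 'rV[R]_n) : enorm x <= k -> (enorm x - k) / C <= 0.
  by move=> xk; rewrite pmulr_lle0 ?invr_gt0// subr_le0.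
split.
  apply: (@bounded_on_le _ _ _ _ C) => x /= /neg xk.
  rewrite /exp_profile normrM (gtr0_norm C0) gtr0_norm ?expR_gt0//.
  by rewrite ler_piMr ?(ltW C0)// -[leRHS]expR0 ler_expR.
(* The factor [C] cancels the slope [1 / C]: the profile is 1-Lipschitz on this ball. *)
move=> e e0; exists e => // x y /neg xk /neg yk.
apply: le_lt_trans; apply: le_trans (enorm_dist_le _ _).
rewrite /exp_profile -mulrBr normrM (gtr0_norm C0) -ler_pdivlMl//.
apply: le_trans (expR_lipschitz_neg xk yk) _.
rewrite -mulrBl opprB addrA subrK normrM mulrC.
by rewrite (@gtr0_norm _ C^-1) ?invr_gt0.
Qed.

(** Here [b] stands for [|x| - k] and [s] for the rate at which the norm is allowed to change along
    a ray; the function is the resulting comparison profile. *)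
Lemma is_derive_exp_profile (R : realType) (C b s : R) : 0 < C ->
  is_derive (0 : R) 1 (fun t => C * expR ((b + t * s) / C)) (expR (b / C) * s).
Proof.
move=> C0; have dl : is_derive (0 : R) 1 (fun t => (b + t * s) / C) (s / C).
  have -> : (fun t : R => (b + t * s) / C) = (fun t => C^-1 *: (b + s *: t)).
    by apply/funext => t; rewrite mulrC (mulrC t).
  apply: is_derive_eq; rewrite add0r mul1r [RHS]mulrC; congr (_ * _).
  exact: mulr1.
have de : is_derive (0 : R) 1 (fun t => expR ((b + t * s) / C))
    (expR ((b + 0 * s) / C) * (s / C)).
  exact: (@is_derive1_comp _ expR _ _ _ _ (is_derive_expR _) dl).
apply: is_derive_eq; rewrite mul0r addr0 (_ : forall a b : R, a *: b = a * b)//.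
by field; rewrite gt_eqF.
Qed.

Lemma near0_ge0 (R : realType) : \forall t \near (0 : R)^'+, 0 <= t.
Proof. by near=> t; apply: ltW; near: t; exact: nbhs_right_gt.
Unshelve. all: by end_near. Qed.

Lemma near_eball (R : realType) (n : nat) (k : R) (x : 'rV[R]_n) :
  enorm x < k -> \forall y \near x, eball k y.
Proof.
move=> xk; apply/near_enormP; exists (k - enorm x); first by rewrite subr_gt0.
by move=> y; have := enorm_sub_le y x; rewrite /eball/=; lra.
Qed.

(** Both [|p| <= a] and [a <= |p|] are proved for the gradient [p] of the test function. The first,
    with [a <= 1], places [p] where [ring_well] is [- C |p|]; the second is then the required
    inequality [C a <= C |p|]. *)
Lemma exp_profile_subsolution (R : realType) (n : nat) (C k : R) : (0 < n)%N ->
  0 < C -> viscosity_subsolution (ring_well C) (@eball R n k) (exp_profile C k).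
Proof.
move=> n0 C0; split.
  by apply: BUC_sub (BUC_exp_profile n k C0) => x /ltW.
move=> x phi xk [U [_ sU dphi _]] ext.
set a := expR ((enorm x - k) / C); set p := grad phi x.
have a0 : 0 < a by exact: expR_gt0.
have incr v s : (forall t, 0 <= t -> enorm x + t * s <= enorm (x + t *: v)) ->
    a * s <= dot p v.
  move=> sv.
  apply: (dot_grad_ge (dphi _ (sU _ xk))
    (is_derive_exp_profile (enorm x - k) s C0)).
  apply: filterS3 (near0_ge0 R) (near_line v (near_eball xk)) (near_line v ext).
  move=> t t0 tk /(_ tk); rewrite mul0r addr0 /exp_profile -/a.
  have : C * expR ((enorm x - k + t * s) / C) <=
      C * expR ((enorm (x + t *: v) - k) / C).
    by rewrite ler_pM2l// ler_expR ler_pM2r ?invr_gt0// addrAC lerD2r sv.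
  lra.
(* Direction [- p], along which the norm decreases at rate at most [|p|]. *)
have pa : enorm p <= a.
  have [->|p0] := eqVneq (enorm p) 0; first exact: ltW.
  have {}p0 : 0 < enorm p by rewrite lt_def p0 enorm_ge0.
  rewrite -(ler_pM2r p0) -expr2 sqr_enorm -lerN2 -mulrN.
  rewrite -[X in _ <= X]mulN1r -dotZr; apply: incr => t t0.
  rewrite mulrN scalerA mulrN1 scaleNr.
  by have := enorm_sub_le x (t *: p); rewrite enormZ ger0_norm.
have ap : a <= enorm p.
  (* An outward direction: [x] itself, or at the kink [x = 0] any nonzero vector, which exists
     because [n] is positive. *)
  have [v [v0 hv]] : exists v, 0 < enorm v /\
      forall t, 0 <= t -> enorm x + t * enorm v <= enorm (x + t *: v).
    have [->|x0] := eqVneq x 0.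
      exists (const_mx 1); split=> [|t t0].
        rewrite lt_def enorm_ge0 andbT; apply/eqP => /enorm_eq0/rowP.
        by move=> /(_ (Ordinal n0)); rewrite !mxE => /eqP; rewrite oner_eq0.
      by rewrite enorm0 !add0r enormZ ger0_norm.
    exists x; split=> [|t t0].
      by rewrite lt_def enorm_ge0 andbT; apply: contra x0 => /eqP/enorm_eq0 ->.
    have -> : x + t *: x = (1 + t) *: x by rewrite scalerDl scale1r.
    rewrite enormZ ger0_norm ?addr_ge0//.
    by rewrite mulrDl mul1r.
  rewrite -(ler_pM2r v0); apply: le_trans (dot_le_enorm p v).
  exact: incr.
have a1 : a <= 1.
  by rewrite -expR0 ler_expR pmulr_lle0 ?invr_gt0// subr_le0 ltW.
rewrite ring_well_in ?(le_trans pa)// /exp_profile -/a subr_le0.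
by rewrite ler_pM2l.
Qed.

(** Inside the ball only [|p| <= a] is needed, obtained along [p], where the norm grows at rate at
    most [|p|]; the kink at 0 needs no separate treatment. *)
Lemma exp_profile_supersolution (R : realType) (n : nat) (C k : R) :
  0 < C ->
  viscosity_supersolution (ring_well C) (@eball R n k) (exp_profile C k).
Proof.
move=> C0; split.
  by apply: BUC_sub (BUC_exp_profile n k C0) => x /closure_eball_le.
move=> x phi xk [U [_ sU dphi _]] ext.
set a := expR ((enorm x - k) / C); set p := grad phi x.
have a0 : 0 < a by exact: expR_gt0.
(* On the sphere the profile is at least [C] and [ring_well] never drops below [- C], so the
   inequality holds for every gradient. *)
have [kx|xk'] := lerP k (enorm x).
  have a1 : 1 <= a.
    by rewrite -[leLHS]expR0 ler_expR divr_ge0 ?(ltW C0)// subr_ge0.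
  have : C * 1 <= C * a by rewrite ler_pM2l.
  by have := ring_well_ge p C0; rewrite /exp_profile -/a; lra.
have pa : enorm p <= a.
  have [->|p0] := eqVneq (enorm p) 0; first exact: ltW.
  have {}p0 : 0 < enorm p by rewrite lt_def p0 enorm_ge0.
  rewrite -(ler_pM2r p0) -expr2 sqr_enorm.
  apply: (dot_grad_le (dphi _ (sU _ xk))
    (is_derive_exp_profile (enorm x - k) (enorm p) C0)).
  apply: filterS3 (near0_ge0 R) (near_line p (near_eball xk'))
    (near_line p ext).
  move=> t t0 /subset_closure tk /(_ tk); rewrite mul0r addr0 /exp_profile -/a.
  have : C * expR ((enorm (x + t *: p) - k) / C) <=
      C * expR ((enorm x - k + t * enorm p) / C).
    rewrite ler_pM2l// ler_expR ler_pM2r ?invr_gt0// addrAC lerD2r.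
    by have := enormD x (t *: p); rewrite enormZ ger0_norm.
  lra.
have a1 : a <= 1.
  by rewrite -expR0 ler_expR pmulr_lle0 ?invr_gt0// subr_le0 ltW.
by rewrite ring_well_in ?(le_trans pa)// /exp_profile -/a subr_ge0 ler_pM2l.
Qed.

Unset Implicit Arguments.

Theorem corollary1p3 (R : realType) (n : nat) (n_gt0 : (0 < n)%N) :
  (* the estimate *)
  (forall H : 'rV[R]_n -> R, locally_lipschitz H -> coercive H ->
    exists2 C : R, 0 < C &
    forall u : 'rV[R]_n -> R, state_constraint_solution H [set: 'rV[R]_n] u ->
      (forall x, u x = - H 0) /\
      forall (k : nat) (u_k : 'rV[R]_n -> R), (0 < k)%N ->
        state_constraint_solution H (eball k%:R) u_k ->
        (forall x, closure (eball k%:R) x ->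
           0 <= u_k x - u x
             <= (C * expR (enorm x / C)) * expR (- (k%:R / C))) /\
        (forall r : R, 0 < r -> r <= k%:R -> forall x, closure (eball r) x ->
           0 <= u_k x - u x
             <= (C * expR (r / C)) * expR (- (k%:R / C)))) /\
  (* optimality: for every C > 0 the estimate is an equality for some H *)
  (forall C : R, 0 < C ->
    exists (H : 'rV[R]_n -> R) (u : 'rV[R]_n -> R)
           (u_ : nat -> 'rV[R]_n -> R),
      [/\ locally_lipschitz H, coercive H,
          state_constraint_solution H [set: 'rV[R]_n] u,
          (forall k : nat, (0 < k)%N ->
             state_constraint_solution H (eball k%:R) (u_ k))
        & (forall (k : nat) x, (0 < k)%N -> closure (eball k%:R) x ->
             u_ k x - u x = (C * expR (enorm x / C)) * expR (- (k%:R / C)))]).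
Proof.
split=> [H HL Hco|C C0].
  have [C C0 HC] := coercive_lower_bound HL Hco.
  exists C => // u usol; have uE := whole_space_solution HL usol.
  split=> // k u_k _ ksol.
  have est x : closure (eball k%:R) x ->
      0 <= u_k x - u x <= C * expR (enorm x / C) * expR (- (k%:R / C)).
    move=> xk; rewrite uE opprK eball_solution_le// andbT -lerBlDr sub0r.
    exact: eball_supersolution_ge ksol.2 _ xk.
  split=> // r r0 rk x xr.
  have xk : closure (eball k%:R) x.
    by apply: closure_subset xr => y; rewrite /eball/= => /lt_le_trans; apply.
  have /andP[-> /le_trans->]// := est x xk.
  rewrite ler_pM2r ?expR_gt0// ler_pM2l// ler_expR ler_pM2r ?invr_gt0//.
  exact: closure_eball_le.
(* One Hamiltonian serves all [k], so the exponential rate itself is attained along the whole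
   sequence. *)
exists (ring_well C), (fun=> 0), (fun k => exp_profile C k%:R); split.
- exact: locally_lipschitz_ring_well.
- exact: coercive_ring_well.
- exact: state_constraint_zero.
- move=> k _; split; first exact: exp_profile_subsolution.
  exact: exp_profile_supersolution.
- by move=> k x _ _; rewrite subr0 -mulrA -expRD -mulrBl.
Qed.
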